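(* Let $X$ be an infinite compact metric space and $f:X\to X$ a continuous map with the specification property. Then there is a residual subset $R$ of $X$ such that $$\lim_{\epsilon\to0}\frac{\log\mathscr E_x(\epsilon,f)}{-\log\epsilon}=\infty\quad\text{for all }x\in R.$$
   Context: $\mathcal P(X)$ is the space of Borel probability measures on $X$ with the first Wasserstein metric $d=W_1$, $W_1(\mu,\nu)=\inf_\pi\int d_X(x,y)\,d\pi(x,y)$, the infimum being over all couplings $\pi$ of $\mu$ and $\nu$. Empirical measures: $\delta_x^n=\frac1n\sum_{j=0}^{n-1}\delta_{f^j(x)}$. The pointwise emergence at scale $\epsilon>0$ at $x\in X$ is $$\mathscr E_x(\epsilon,f)=\min\Big\{N\in\mathbb N \mid \exists\,\{\mu_j\}_{j=1}^N\subset\mathcal P(X)\text{ with }\limsup_{n\to\infty}\min_{1\le j\le N}d(\delta_x^n,\mu_j)\le\epsilon\Big\}.$$ Specification property: for any $\epsilon>0$ there exists a constant $\tau(\epsilon)\ge0$ such that for any integer $K\ge1$, any points $p_1,\dots,p_K\in X$, and any positive integers $n_1,\dots,n_K$ and $m_1,\dots,m_K$ with $m_k-n_k\ge\tau(\epsilon)$ for $1\le k\le K$, there exists a periodic point $x\in X$ of period $N_K$ (i.e. $f^{N_K}(x)=x$) such that, with $N_k=\sum_{j=1}^k m_j$ and $N_0=0$, for every $1\le k\le K$, $$f^n(x)\in B_\epsilon(f^n(p_k))\quad\text{if } n\in[N_{k-1},N_{k-1}+n_k-1]\cap\mathbb Z,$$ where $B_r(y)$ is the ball of radius $r$ centered at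 $y$. *)

(* Defs.v *)
From HB Require Import structures.
From mathcomp Require Import all_boot all_order all_algebra.
From mathcomp Require Import all_classical all_reals all_analysis.
From mathcomp Require Import borel_hierarchy.

Set Implicit Arguments.
Unset Strict Implicit.
Unset Printing Implicit Defensive.

Import Order.TTheory GRing.Theory Num.Theory.
Import numFieldNormedType.Exports.

Local Open Scope classical_set_scope.
Local Open Scope ring_scope.

(* [measurableType]s are pointed, so Borel measures are set up on nonempty
   metric spaces with a (nowhere used) distinguished point. *)
#[short(type="pmetricType")]
HB.structure Definition PointedMetric (K : numDomainType) :=
  {M of Metric K M & Pointed M}.

Definition residual (T : topologicalType) (A : set T) :=
  exists2 G : set T, Gdelta_dense G & G `<=` A.

Section Emergence.
Context {R : realType} {X : pmetricType R}.
Implicit Types (f : X -> X) (x : X).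

Definition specification f :=
  forall eps : R, 0 < eps ->
  exists2 tau : R, 0 <= tau &
  forall (K : nat) (p : nat -> X) (n m : nat -> nat), (1 <= K)%N ->
    (forall k, (k < K)%N ->
      [/\ (0 < n k)%N, (0 < m k)%N & tau <= (m k)%:R - (n k)%:R]) ->
  let N k := (\sum_(j < k) m j)%N in
  exists2 x, iter (N K) f x = x &
    forall k i, (k < K)%N -> (N k <= i < N k + n k)%N ->
      ball (iter i f (p k)) eps (iter i f x).

Definition borel := g_sigma_algebraType (@open X).

(* On a compact (hence second countable) metric space the product
   sigma-algebra carried by [borel * borel] is the Borel sigma-algebra
   of the product. *)
Definition coupling (mu nu : probability borel R) :
    set (probability (borel * borel)%type R) :=
  [set pi | forall A : set borel, measurable A ->
    pi (A `*` setT) = mu A /\ pi (setT `*` A) = nu A].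

Definition wasserstein1 (mu nu : probability borel R) : \bar R :=
  ereal_inf [set (\int[pi]_z (mdist (z.1 : X) (z.2 : X))%:E)%E
            | pi in coupling mu nu].

(* The empirical measure of the first [n.+1] points of the orbit: the index is
   shifted by one so that it is a probability for every [n]. *)
Definition empirical f x (n : nat) : set borel -> \bar R :=
  mscale (n.+1%:R^-1)%:nng
    (msum (fun j => dirac (iter j f x : borel)) n.+1).

HB.instance Definition _ f x n := Measure.on (empirical f x n).

Lemma empirical_setT f x n : empirical f x n setT = 1%E.
Proof.
rewrite /empirical /mscale /= /msum (eq_bigr (fun=> 1%E)); last first.
  by move=> j _; exact: diracT.
rewrite sumEFin -EFinM; congr EFin.
by rewrite sumr_const card_ord mulVf.
Qed.

HB.instance Definition _ f x n :=
  Measure_isProbability.Build _ _ _ (empirical f x n) (empirical_setT f x n).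

(* For [N = 0] the minimum is [+oo], so that [N = 0] never qualifies. *)
Definition approximable f x (eps : R) (N : nat) :=
  exists mu : 'I_N -> probability borel R,
  (limn_esup (fun n =>
     \big[mine/+oo]_(j < N) wasserstein1 (empirical f x n) (mu j))
   <= eps%:E)%E.

(* An infimum of natural numbers is a minimum; it is [+oo] on the empty set,
   a case that compactness of [X] rules out. *)
Definition emergence f x (eps : R) : \bar R :=
  ereal_inf [set N%:R%:E | N in approximable f x eps].

End Emergence.

(* Main.v *)
Require Import Defs.
From HB Require Import structures.
From mathcomp Require Import all_boot all_order all_algebra.
From mathcomp Require Import all_classical all_reals all_analysis.
From mathcomp Require Import measurable_realfun.
From mathcomp Require Import ring lra.

(** The emergence of a generic point is bounded below by testing measures
against finitely many Lipschitz functions.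

Let [psi] be 1-Lipschitz.  Integrals of [psi] against two measures differ by
at most their Wasserstein distance ([wasserstein1_mean_le]), and its integral
against an empirical measure is a Birkhoff average.  So if [N] measures
eventually approximate the empirical measures of [x] up to [eps], then, for
finitely many such functions, all the late vectors of Birkhoff averages at [x]
lie in [N] cubes of side of order [eps].  It remains to find, in every
dimension [d], [d] test functions whose vector of averages at a generic point
keeps returning close to every point of a [d]-dimensional grid: this forces [N]
to be at least the number of grid points that the cubes can tell apart, which
is of order [eps^-d].

The test functions come from [d + 1] pairwise disjoint periodic orbits.  These
exist because periodic points are dense and [X] is infinite
([disjoint_periodic_orbits]).  If the distance between any two of the orbits is
at least [r], a tent function of height [r] over the [i]-th orbit vanishes on
all the others ([separating_tents]).  By the specification property, every open
set contains a point that shadows the orbits one after the other during long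
blocks of prescribed relative lengths; its average of the [i]-th tent function
is then close to [r] times the proportion of time spent near the [i]-th orbit
([specification_birkhoff]).  The last orbit takes up the time left over by the
other ones, so every point of the grid [(r / (m * d)) * {0, ..., m-1}^d] can be
prescribed.  For a given grid point, the points of [X] with a late average
vector close to it thus form a dense open set ([revisits_open],
[revisits_dense]), and a generic point belongs to all of these sets, over all
dimensions, meshes and grid points.

A grid with [m^d] points is resolved as soon as [8 * m * d * eps <= r]
([emergence_ge]).  Taking [m] of order [eps^(-1/2)] meets this condition for
small [eps], whatever [r] and [d], and gives an emergence of at least
[eps^(-d/2)] ([grid_size_near0]); finally [d] is arbitrary. *)

Set Implicit Arguments.
Unset Strict Implicit.
Unset Printing Implicit Defensive.

Import Order.TTheory GRing.Theory Num.Theory.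
Import numFieldNormedType.Exports.

Local Open Scope classical_set_scope.
Local Open Scope ring_scope.

(** * Wasserstein distance and test functions *)

Section Integral.
Context {R : realType}.

(** The integral of a nonnegative function is a supremum over the simple
functions below it, hence monotone without measurability.  This makes it
possible to integrate the distance against a coupling without showing that it
is measurable for the product sigma-algebra. *)
Lemma ge0_le_integral_nonmeasurable d (T : measurableType d)
    (mu : {measure set T -> \bar R}) (g h : T -> \bar R) :
  (forall x, 0 <= g x)%E -> (forall x, g x <= h x)%E ->
  (\int[mu]_x g x <= \int[mu]_x h x)%E.
Proof.
move=> g0 gh; rewrite !ge0_integralTE//; last first.
  by move=> x; exact: le_trans (gh x).
apply: le_ereal_sup => _ [k /= kg <-]; exists k => //= x.
exact: le_trans (gh x).
Qed.

(** Additivity may fail when [c] is not measurable; the positive part of [g - h]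
is measurable and squeezed between [g - h] and [c]. *)
Lemma le_integralD_nonmeasurable d (T : measurableType d)
    (mu : {measure set T -> \bar R}) (g h c : T -> R) :
  measurable_fun setT g -> measurable_fun setT h ->
  (forall x, 0 <= g x) -> (forall x, 0 <= h x) -> (forall x, 0 <= c x) ->
  (forall x, g x <= h x + c x) ->
  (\int[mu]_x (g x)%:E <= \int[mu]_x (h x)%:E + \int[mu]_x (c x)%:E)%E.
Proof.
move=> mg mh g0 h0 c0 ghc.
pose k x := Num.max (g x - h x) 0.
have mk : measurable_fun setT k.
  by apply: measurable_maxr => //; exact: measurable_funB.
have k0 x : 0 <= k x by rewrite le_max lexx orbT.
apply: (@le_trans _ _ (\int[mu]_x ((h x)%:E + (k x)%:E))%E).
  apply: ge0_le_integral_nonmeasurable => x; rewrite lee_fin//.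
  by rewrite -lerBlDl le_max lexx.
rewrite ge0_integralD//; try (by move=> x _; rewrite lee_fin);
  try exact/measurable_EFinP.
apply: leeD2l; apply: ge0_le_integral_nonmeasurable => x; rewrite lee_fin//.
by rewrite ge_max c0 andbT lerBlDl.
Qed.

End Integral.

Section Wasserstein.
Context {R : realType} {X : pmetricType R}.
Local Notation borelX := (@borel R X).
Implicit Types (psi : X -> R).

(** One inequality suffices: exchanging [x] and [y] gives the other one. *)
Definition nonexpansive psi := forall x y, psi x <= psi y + mdist x y.

Definition mean (mu : probability borelX R) psi : R :=
  (\int[mu]_x psi x)%R.

Lemma nonexpansive_continuous psi : nonexpansive psi -> continuous psi.
Proof.
move=> psi_lip x; apply/cvgrPdist_lt => e e0; near=> y.
have xy : mdist x y < e.
  have : ball x e y by near: y; exact: nbhsx_ballx.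
  by rewrite ballEmdist.
rewrite ltr_norml; have := psi_lip x y; have := psi_lip y x.
rewrite (metric_sym y x); lra.
Unshelve. all: by end_near. Qed.

Lemma nonexpansive_measurable psi :
  nonexpansive psi -> measurable_fun setT (psi : borelX -> R).
Proof.
move=> /nonexpansive_continuous /continuousP psi_cont.
apply: (measurability _ (RGenOInfty.measurableE R)).
move=> _ [_ [a ->] <-]; rewrite setTI.
by apply: sub_sigma_algebra; apply: psi_cont; exact: interval_open.
Qed.

(** Stated for a projection [p], to cover both marginals of a coupling. *)
Lemma marginal_integral (mu : probability borelX R)
    (pi : probability (borelX * borelX)%type R)
    (p : borelX * borelX -> borelX) psi :
  measurable_fun setT p ->
  (forall A, measurable A -> pi (p @^-1` A) = mu A) ->
  nonexpansive psi -> (forall x, 0 <= psi x) ->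
  (\int[mu]_x (psi x)%:E = \int[pi]_z (psi (p z))%:E)%E.
Proof.
move=> mp pimu psi_lip psi0.
have mpsi := nonexpansive_measurable psi_lip.
rewrite (@eq_measure_integral _ _ _ _ (pushforward pi p)); last first.
  by move=> A mA _; exact/esym/pimu.
rewrite ge0_integral_pushforward ?preimage_setT//.
- exact/measurable_EFinP.
- by move=> x _; rewrite lee_fin.
Qed.

Lemma mean_EFin mu psi r : nonexpansive psi -> (forall x, 0 <= psi x <= r) ->
  ((mean mu psi)%:E = \int[mu]_x (psi x)%:E)%E.
Proof.
move=> psi_lip psi0r; rewrite /mean /Rintegral fineK//.
have psi0 x : 0 <= psi x by case/andP: (psi0r x).
rewrite ge0_fin_numE; last by apply: integral_ge0 => x _; rewrite lee_fin.
apply: (@le_lt_trans _ _ (\int[mu]_x (r%:E))%E).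
  apply: ge0_le_integral_nonmeasurable => x; rewrite lee_fin//.
  by case/andP: (psi0r x).
rewrite integral_cst//.
by rewrite [X in (_ * X)%E](probability_setT mu) mule1 ltry.
Qed.

(** The elementary half of Kantorovich duality: any coupling transports one
mean to the other at a cost that dominates the variation of [psi]. *)
Lemma wasserstein1_mean_le mu nu psi r delta :
  nonexpansive psi -> (forall x, 0 <= psi x <= r) ->
  (wasserstein1 mu nu < delta%:E)%E ->
  `|mean mu psi - mean nu psi| <= delta.
Proof.
move=> psi_lip psi0r /ereal_inf_lt[_ [pi pimunu <-]] /ltW pidelta.
have psi0 x : 0 <= psi x by case/andP: (psi0r x).
have mpsi := nonexpansive_measurable psi_lip.
have mean1 : ((mean mu psi)%:E = \int[pi]_z (psi z.1)%:E)%E.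
  rewrite (mean_EFin _ psi_lip psi0r).
  apply: (marginal_integral (p := fst)) => // A mA.
  by rewrite -(proj1 (pimunu A mA)) setXT.
have mean2 : ((mean nu psi)%:E = \int[pi]_z (psi z.2)%:E)%E.
  rewrite (mean_EFin _ psi_lip psi0r).
  apply: (marginal_integral (p := snd)) => // A mA.
  by rewrite -(proj2 (pimunu A mA)) setTX.
have m1 : measurable_fun setT (fun z : borelX * borelX => psi z.1).
  exact: measurableT_comp mpsi measurable_fst.
have m2 : measurable_fun setT (fun z : borelX * borelX => psi z.2).
  exact: measurableT_comp mpsi measurable_snd.
have d0 (z : borelX * borelX) : 0 <= mdist (z.1 : X) (z.2 : X).
  exact: mdist_ge0.
have le12 : mean mu psi <= mean nu psi + delta.
  rewrite -lee_fin EFinD mean1 mean2.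
  apply: le_trans (leeD2l _ pidelta); exact: le_integralD_nonmeasurable.
have le21 : mean nu psi <= mean mu psi + delta.
  rewrite -lee_fin EFinD mean1 mean2.
  apply: le_trans (leeD2l _ pidelta); apply: le_integralD_nonmeasurable => //.
  by move=> z; rewrite metric_sym; exact: psi_lip.
by apply/ler_normlP; split; lra.
Qed.

Lemma mean_empirical f x n psi : nonexpansive psi -> (forall y, 0 <= psi y) ->
  mean (empirical f x n) psi = n.+1%:R^-1 * \sum_(j < n.+1) psi (iter j f x).
Proof.
move=> psi_lip psi0.
have mpsi : measurable_fun setT (EFin \o (psi : borelX -> R)).
  by apply/measurable_EFinP; exact: nonexpansive_measurable.
have psi0E (y : borelX) : [set: borelX] y -> (0 <= (psi y)%:E)%E.
  by rewrite lee_fin.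
rewrite /mean /Rintegral.
rewrite (@eq_measure_integral _ _ _ _ (mscale (n.+1%:R^-1)%:nng
    (msum (fun j => dirac (iter j f x : borelX)) n.+1)))//.
rewrite ge0_integral_mscale// ge0_integral_measure_sum//.
rewrite (eq_bigr (fun j : 'I_n.+1 => (psi (iter j f x))%:E)); last first.
  by move=> j _; rewrite integral_dirac// diracT mul1e.
by rewrite sumEFin -EFinM.
Qed.

End Wasserstein.

(** * Prescribing Birkhoff averages *)

Section Birkhoff.
Context {R : realType} {X : pmetricType R}.
Implicit Types (f : X -> X) (psi : X -> R).

Definition birkhoff f psi n (x : X) : R :=
  n.+1%:R^-1 * \sum_(j < n.+1) psi (iter j f x).

Lemma iter_continuous f n : continuous f -> continuous (iter n f).
Proof.
move=> cf; elim: n => [|n IHn] x /=; first exact: cvg_id.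
exact: (continuous_comp (IHn x) (cf _)).
Qed.

Lemma birkhoff_continuous f psi n :
  continuous f -> nonexpansive psi -> continuous (birkhoff f psi n).
Proof.
move=> cf psi_lip x; apply: cvgMl_tmp; apply: cvg_big => [|j _].
  exact: add_continuous.
apply: (@cvg_comp _ _ _ (iter j f) psi _ _ _ (iter_continuous cf (x := x))).
exact: nonexpansive_continuous.
Qed.

(** [F] is close to the constant [w k] during the first [l k] steps of the
[k]-th block, and merely bounded by [r] during the [g] steps of the gap that
ends the block. *)
Lemma block_sum (F w : nat -> R) (l : nat -> nat) (g K : nat) (r e : R) :
  let N k := (\sum_(j < k) (l j + g))%N in
  (forall j, 0 <= F j <= r) ->
  (forall k j, (k < K)%N -> (j < l k)%N -> `|F (N k + j)%N - w k| <= e) ->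
  `|\sum_(j < N K) F j - \sum_(k < K) (l k)%:R * w k|
    <= (\sum_(k < K) l k)%:R * e + (K * g)%:R * r.
Proof.
move=> N F0r; elim: K => [_|K IHK Fw].
  by rewrite /N !big_ord0 subrr normr0 !mul0r add0r.
have {}IHK := IHK (fun k j kK => Fw k j (ltnW kK)).
have -> : N K.+1 = (N K + (l K + g))%N by rewrite /N big_ord_recr.
rewrite !big_split_ord/= (big_ord_recr K)/= [in X in _ <= X]big_ord_recr/=.
set S := \sum_(i < N K) _ in IHK *; set W := \sum_(i < K) _ in IHK *.
set S1 := \sum_(i < l K) _; set S2 := \sum_(i < g) _.
have S1e : `|S1 - (l K)%:R * w K| <= (l K)%:R * e.
  have -> : S1 - (l K)%:R * w K = \sum_(i < l K) (F (N K + i)%N - w K).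
    by rewrite sumrB sumr_const card_ord [in LHS]mulr_natl.
  apply: le_trans (ler_norm_sum _ _ _) _.
  rewrite mulr_natl -[X in _ *+ X](card_ord (l K)) -sumr_const.
  by apply: ler_sum => i _; exact: Fw.
have S2r : `|S2| <= g%:R * r.
  apply: le_trans (ler_norm_sum _ _ _) _.
  rewrite mulr_natl -[X in _ *+ X](card_ord g) -sumr_const.
  apply: ler_sum => i _.
  by case/andP: (F0r (N K + (l K + i))%N) => F0 Fr; rewrite ger0_norm.
rewrite mulSn !natrD.
have -> : S + (S1 + S2) - (W + (l K)%:R * w K) =
  (S - W) + (S1 - (l K)%:R * w K) + S2 by ring.
apply: le_trans (ler_normD _ _) _.
have := ler_normD (S - W) (S1 - (l K)%:R * w K).
move: IHK S1e S2r; rewrite natrM; lra.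
Qed.

(** Besides the error [e] inside the blocks, the gaps are counted twice: once
for the values of [F] there, once because they make the total length [N] exceed
[L] times the sum of the weights. *)
Lemma block_average (F w : nat -> R) (a : nat -> nat) (g K L : nat) (r e : R) :
  let N := (\sum_(k < K) (a k * L + g))%N in
  (0 < L)%N -> (0 < \sum_(k < K) a k)%N ->
  (forall k, 0 <= w k <= r) -> (forall j, 0 <= F j <= r) -> 0 <= e ->
  (forall k j, (k < K)%N -> (j < a k * L)%N ->
    `|F (\sum_(i < k) (a i * L + g) + j)%N - w k| <= e) ->
  `|N%:R^-1 * \sum_(j < N) F j -
     (\sum_(k < K) (a k)%:R * w k) / (\sum_(k < K) a k)%:R|
    <= e + 2 * (K * g)%:R * r / L%:R.
Proof.
move=> N L0 A0 w0r F0r e0 Fw.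
set A := (\sum_(k < K) a k)%N in A0 *; set W := \sum_(k < K) _ * _.
have NE : N = (A * L + K * g)%N.
  by rewrite /N big_split/= -big_distrl/= sum_nat_const card_ord.
have := @block_sum F w (fun k => a k * L)%N g K r e F0r Fw.
rewrite /= -/N -big_distrl/= -/A.
have -> : \sum_(k < K) (a k * L)%:R * w k = L%:R * W.
  rewrite /W mulr_sumr; apply: eq_bigr => k _.
  by rewrite natrM mulrAC mulrC mulrA.
set S := \sum_(j < N) _ => Sle.
have Apos : 0 < A%:R :> R by rewrite ltr0n.
have A1 : 1 <= A%:R :> R by rewrite ler1n.
have Lpos : 0 < L%:R :> R by rewrite ltr0n.
have N0 : 0 < N%:R :> R by rewrite ltr0n NE addn_gt0 muln_gt0 A0 L0.
set G : R := (K * g)%:R; have G0 : 0 <= G by rewrite ler0n.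
have NR : N%:R = A%:R * L%:R + G :> R by rewrite NE natrD natrM.
pose t := W / A%:R.
have WE : W = A%:R * t by rewrite /t mulrC divfK// gt_eqF.
have r0 : 0 <= r by case/andP: (F0r 0%N); exact: le_trans.
have t0 : 0 <= t.
  apply: divr_ge0 (ltW Apos); apply: sumr_ge0 => k _.
  by case/andP: (w0r k) => ? ?; rewrite mulr_ge0.
have tr : t <= r.
  rewrite /t ler_pdivrMr// /A natr_sum mulr_sumr; apply: ler_sum => k _.
  by case/andP: (w0r k) => ? ?; rewrite mulrC ler_wpM2r.
rewrite -/t.
have -> : N%:R^-1 * S - t = N%:R^-1 * (S - N%:R * t).
  by rewrite mulrBr mulKf// gt_eqF.
rewrite normrM normfV (ger0_norm (ltW N0)) mulrC ler_pdivrMr//.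
have -> : S - N%:R * t = (S - L%:R * W) - G * t.
  by rewrite NR WE; ring.
apply: le_trans (ler_normB _ _) _.
have Gt : `|G * t| <= G * r.
  by rewrite ger0_norm; [exact: ler_wpM2l|exact: mulr_ge0].
have LN : L%:R <= N%:R :> R by rewrite NR; nra.
have NL : 2 * G * r <= 2 * G * r / L%:R * N%:R.
  have -> : 2 * G * r / L%:R * N%:R = 2 * G * r * (N%:R / L%:R) by ring.
  apply: ler_peMr; first by rewrite !mulr_ge0.
  by rewrite ler_pdivlMr// mul1r.
have ALe : A%:R * L%:R * e <= e * N%:R.
  by rewrite mulrC ler_wpM2l// NR lerDl.
move: Sle; rewrite natrM -/G; lra.
Qed.

(** Shadow the points [q k] one after the other, the [k]-th one for a time
proportional to the weight [a k].  Since [psi i] takes the constant value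
[w i k] along the orbit of [q k], its average along the shadowing orbit is
close to the weighted mean of these values: the gaps between the blocks have
bounded length and become negligible when the blocks are long.  As the orbit
shadowed in a block is read at absolute times, it matters that [w i k] does not
depend on the time. *)
Lemma specification_birkhoff f (D : finType) (psi : D -> X -> R) (r : R)
    (K : nat) (q : nat -> X) (w : D -> nat -> R) (a : nat -> nat)
    (eta : R) (M : nat) (u : X) (rho : R) :
  specification f ->
  (forall i, nonexpansive (psi i)) -> (forall i x, 0 <= psi i x <= r) ->
  (forall i k j, (k < K)%N -> psi i (iter j f (q k)) = w i k) ->
  (0 < \sum_(k < K) a k)%N -> 0 < eta -> 0 < rho ->
  exists2 x, ball u rho x & exists2 n, (M <= n)%N & forall i,
   `|birkhoff f (psi i) n x -
     (\sum_(k < K) (a k)%:R * w i k) / (\sum_(k < K) a k)%:R| < eta.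
Proof.
move=> specf psi_lip psi0r psiq A0 eta0 rho0.
pose e := Num.min rho (eta / 3).
have e0 : 0 < e by rewrite lt_min rho0 divr_gt0.
have [tau tau0 {}specf] := specf e e0.
pose T := (Num.trunc tau).+1.
have tauT : tau <= T%:R by apply/ltW/truncnS_gt.
pose g := T.+1.
(* A first block, of weight 0, makes the shadowing orbit start near [u]. *)
pose q' k := if k is k'.+1 then q k' else u.
pose a' k := if k is k'.+1 then a k' else 0%N.
pose w' i k := if k is k'.+1 then if (k' < K)%N then w i k' else 0 else 0.
(* [L] is large enough for the gaps to contribute at most [eta / 3]. *)
pose C : R := 2 * (K.+1 * g)%:R * r.
pose L := (M + Num.trunc (`|C| / (eta / 3))).+1.
have L0 : (0 < L)%N by [].
have CL : C / L%:R <= eta / 3.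
  rewrite ler_pdivrMr ?ltr0n// mulrC -ler_pdivrMr ?divr_gt0//.
  apply: (@le_trans _ _ (`|C| / (eta / 3))).
    by rewrite ler_wpM2r ?ler_norm// invr_ge0 divr_ge0// ltW.
  by apply/ltW/(lt_le_trans (truncnS_gt _)); rewrite ler_nat ltnS leq_addl.
have A'E : (\sum_(k < K.+1) a' k = \sum_(k < K) a k)%N.
  by rewrite big_ord_recl/= add0n.
have W'E i : \sum_(k < K.+1) (a' k)%:R * w' i k = \sum_(k < K) (a k)%:R * w i k.
  rewrite big_ord_recl/= mul0r add0r; apply: eq_bigr => k _.
  by rewrite ltn_ord.
(* Blocks have length at least 1, even those of weight 0: hence the [.+1]. *)
have [||x _ xq] := specf K.+1 q' (fun k => (a' k * L).+1)
  (fun k => a' k * L + g)%N.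
- by [].
- move=> k _; split=> //; first by rewrite addnS.
  by rewrite addnS -natrB ?ltnS ?leq_addr// subSS addKn.
exists x.
  have := xq 0%N 0%N isT; rewrite big_ord0/= => /(_ isT).
  by apply: le_ball; rewrite ge_min lexx.
set N := (\sum_(k < K.+1) (a' k * L + g))%N.
have ML : (M < N)%N.
  rewrite /N big_split/= -big_distrl/= A'E.
  apply: ltn_addr; apply: (@leq_trans L); first by rewrite /L ltnS leq_addr.
  exact: leq_pmull.
exists N.-1; first by rewrite -ltnS (ltn_predK ML).
move=> i; rewrite /birkhoff (ltn_predK ML) -W'E -A'E.
apply: (@le_lt_trans _ _ (e + 2 * (K.+1 * g)%:R * r / L%:R)).
  apply: (block_average (F := fun j => psi i (iter j f x))) => //.
  - by rewrite A'E.
  - have r0 : 0 <= r by case/andP: (psi0r i u); exact: le_trans.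
    move=> [|k]/=; first by rewrite lexx.
    case: ifP => kK; last by rewrite lexx.
    by rewrite -(psiq i k 0%N kK).
  - exact: ltW.
  move=> [|k] j kK; first by rewrite mul0n.
  move=> jk; set m := (_ + j)%N.
  have := xq k.+1 m kK; rewrite /m leq_addr ltn_add2l ltnS (ltnW jk) -/m.
  rewrite ballEmdist/= => /(_ isT) /ltW qx.
  rewrite /w' -ltnS kK -(psiq i k m kK).
  have := psi_lip i (iter m f (q k)) (iter m f x).
  have := psi_lip i (iter m f x) (iter m f (q k)).
  rewrite [X in _ <= _ + X -> _]metric_sym => h1 h2.
  by apply/ler_normlP; split; lra.
have : e <= eta / 3 by rewrite ge_min lexx orbT.
rewrite -/C; lra.
Qed.

End Birkhoff.

(** * Periodic orbits and separating functions *)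

Section PeriodicOrbits.
Context {R : realType} {X : pmetricType R}.
Implicit Types (f : X -> X).

(** The distance to the finite set [p], truncated at [r] and turned upside
down. *)
Definition tent (n : nat) (p : 'I_n -> X) (r : R) (x : X) : R :=
  \big[Num.max/0]_(j < n) (r - mdist (p j) x).

Section Tent.
Context (n : nat) (p : 'I_n -> X) (r : R).

Lemma tent_nonexpansive : nonexpansive (tent p r).
Proof.
move=> x y; rewrite [X in X <= _]/tent; apply: bigmax_le => [|j _].
  by rewrite addr_ge0 ?mdist_ge0//; exact: bigmax_ge_id.
apply: (@le_trans _ _ (r - mdist (p j) y + mdist x y)).
  have := metric_triangle (p j) x y; lra.
by rewrite lerD2r; exact: le_bigmax.
Qed.

Lemma tent_bounds : 0 <= r -> forall x, 0 <= tent p r x <= r.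
Proof.
move=> r0 x; rewrite bigmax_ge_id/=; apply: bigmax_le => // j _.
by rewrite gerBl mdist_ge0.
Qed.

Lemma tent_center j : 0 <= r -> tent p r (p j) = r.
Proof.
move=> r0; apply/eqP; rewrite eq_le.
have /andP[_ ->] /= := tent_bounds r0 (p j).
have := le_bigmax 0 (fun i => r - mdist (p i) (p j)) j.
by rewrite mdistxx subr0.
Qed.

Lemma tent_far x : (forall j, r <= mdist (p j) x) -> tent p r x = 0.
Proof.
move=> far; apply/eqP; rewrite eq_le bigmax_ge_id andbT.
by apply: bigmax_le => // j _; rewrite subr_le0.
Qed.
End Tent.

Lemma finite_separation (I : finType) (d : I -> R) :
  (forall i, 0 < d i) -> exists2 r, 0 < r & forall i, r <= d i.
Proof.
move=> d0; exists (\big[Num.min/1]_i d i); first exact: lt_bigmin.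
by move=> i; exact: bigmin_le.
Qed.

Lemma iter_modn f P x n : iter P f x = x -> iter (n %% P) f x = iter n f x.
Proof.
move=> fPx; rewrite {2}(divn_eq n P) addnC iterD; congr iter.
by elim: (n %/ P)%N => [//|k IHk]; rewrite mulSn iterD -IHk.
Qed.

Lemma periodic_dense f u e : specification f -> 0 < e ->
  exists2 x, ball u e x & exists2 P, (0 < P)%N & iter P f x = x.
Proof.
move=> specf e0; have [tau tau0 {}specf] := specf e e0.
pose m := (Num.trunc tau).+2.
have [|k|x xx xu] := specf 1%N (fun=> u) (fun=> 1%N) (fun=> m).
- by [].
- by rewrite -natrB//= subn1/=; split=> //; exact: ltW (truncnS_gt _).
exists x; last by exists (\sum_(j < 1) m)%N; [rewrite big_ord1|exact: xx].
by have := xu 0%N 0%N isT; rewrite big_ord0/=; apply.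
Qed.

(** The orbits found so far form a finite set, so some ball avoids them, and it
contains a periodic point.  A periodic orbit that meets an invariant set is
contained in it, so the orbit of this point avoids the previous ones as well.
A common period [P] lets all the orbits be indexed by ['I_P]. *)
Lemma disjoint_periodic_orbits f n : infinite_set [set: X] -> specification f ->
  exists q : nat -> X, exists P,
  [/\ (0 < P)%N, forall k, (k < n)%N -> iter P f (q k) = q k &
   forall k l i j, (k < l < n)%N -> iter i f (q k) != iter j f (q l)].
Proof.
move=> infX specf; elim: n => [|n [q [P [P0 qP qsep]]]].
  by exists (fun=> point), 1%N; split=> // k l i j /andP[].
pose orb (t : 'I_n * 'I_P) := iter t.2 f (q t.1).
have [u orbu] : exists u, forall t, orb t != u.
  apply: contrapT => /forallNP cov; apply: infX.
  have : finite_set (range orb) by apply: finite_image; exact: finite_finset.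
  apply: sub_finite_set => u _; have /existsNP[t /negP] := cov u.
  by rewrite negbK => /eqP <-; exists t.
have [e e0 eorb] : exists2 e, 0 < e & forall t, e <= mdist u (orb t).
  by apply: finite_separation => t; rewrite mdist_gt0 eq_sym.
have [x ux [Q Q0 xQ]] := periodic_dense u specf e0.
have xorb t : orb t != x.
  apply: contraTneq (eorb t) => ->; rewrite -ltNge.
  by move: ux; rewrite ballEmdist.
exists (fun k => if (k < n)%N then q k else x), (P * Q)%N; split.
- by rewrite muln_gt0 P0.
- move=> k; rewrite ltnS => kn; case: ifPn => kn'.
    by rewrite -(iter_modn _ (qP _ kn')) modnMr.
  by rewrite -(iter_modn _ xQ) modnMl.
move=> k l i j /andP[kl]; rewrite ltnS leq_eqVlt => /predU1P[ln|ln]; last first.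
  by rewrite ln (ltn_trans kl ln); apply: qsep; rewrite kl.
rewrite ln ltnn -ln kl; apply/eqP => qx.
have kn : (k < n)%N by rewrite -ln.
(* Completing [j] to a multiple of the period brings the orbit back to [x]. *)
have : iter (j * Q - j) f (iter j f x) = x.
  by rewrite -iterD subnK ?leq_pmulr// -(iter_modn _ xQ) modnMl.
rewrite -qx -iterD -(iter_modn _ (qP _ kn)).
have ltP : ((j * Q - j + i) %% P < P)%N by rewrite ltn_mod.
move=> /eqP; apply/negP; exact: (xorb (Ordinal kn, Ordinal ltP)).
Qed.

(** There is one orbit more than functions: all the functions vanish on the
orbit of [q d], where time can be spent without affecting any average. *)
Lemma separating_tents f d : infinite_set [set: X] -> specification f ->
  exists r : R, exists psi : 'I_d -> X -> R, exists q : nat -> X,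
  [/\ 0 < r, forall i, nonexpansive (psi i),
      forall i x, 0 <= psi i x <= r &
      forall i k j, (k < d.+1)%N ->
        psi i (iter j f (q k)) = r *+ (i == k :> nat)].
Proof.
move=> infX specf.
have [q [P [P0 qP qsep]]] := disjoint_periodic_orbits d.+1 infX specf.
(* Pairs on the same orbit get the harmless value 1. *)
pose sep (t : 'I_d.+1 * 'I_P * ('I_d.+1 * 'I_P)) : R :=
  if t.1.1 == t.2.1 then 1 else
  mdist (iter t.1.2 f (q t.1.1)) (iter t.2.2 f (q t.2.1)).
have [r r0 rsep] : exists2 r, 0 < r & forall t, r <= sep t.
  apply: finite_separation => -[[k i] [l j]]; rewrite /sep /=.
  case: eqVneq => // kl; rewrite mdist_gt0.
  have := kl; rewrite -val_eqE neq_ltn => /orP[kl'|lk].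
    by apply: qsep; rewrite kl' /=.
  by rewrite eq_sym; apply: qsep; rewrite lk /=.
have r0' := ltW r0.
exists r, (fun i => tent (fun j : 'I_P => iter j f (q i)) r), q; split=> //.
- by move=> i; exact: tent_nonexpansive.
- by move=> i; exact: tent_bounds.
move=> i k j kd.
have jP : (j %% P < P)%N by rewrite ltn_mod.
rewrite -(iter_modn _ (qP _ kd)); case: eqVneq => [<-|ik].
  exact: (tent_center (fun j : 'I_P => iter j f (q i)) (Ordinal jP)).
apply: tent_far => j'.
have := rsep (widen_ord (leqnSn d) i, j', (Ordinal kd, Ordinal jP)).
by rewrite /sep/= -val_eqE/= (negbTE ik).
Qed.

End PeriodicOrbits.

(** * Counting grid points *)

Section Emergence.
Context {R : realType} {X : pmetricType R}.
Implicit Types (f : X -> X).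

(** The points whose vector of averages is, at some time after [M], close to
the grid point [(r / (m * d)) * c].  The tolerance is a quarter of the mesh
[r / (m * d)], so that as much is left for the error on the measures. *)
Definition revisits f (d : nat) (psi : 'I_d -> X -> R) (r : R) (m : nat)
    (c : 'I_d -> nat) (M : nat) : set X :=
  [set x | exists2 n, (M <= n)%N & forall i,
    `|birkhoff f (psi i) n x - r * (c i)%:R / (m * d)%:R|
      < r / (4 * (m * d)%:R)].

Lemma revisits_open f d (psi : 'I_d -> X -> R) r m c M :
  continuous f -> (forall i, nonexpansive (psi i)) ->
  open (revisits f psi r m c M).
Proof.
move=> cf psi_lip; rewrite openE => x [n Mn xn].
have : \forall y \near x, forall i,
    `|birkhoff f (psi i) n y - r * (c i)%:R / (m * d)%:R|
      < r / (4 * (m * d)%:R).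
  apply: filter_forall => i.
  have cg : continuous
      (fun y => `|birkhoff f (psi i) n y - r * (c i)%:R / (m * d)%:R|).
    move=> y; apply: cvg_norm; apply: cvgB; last exact: cvg_cst.
    exact: birkhoff_continuous.
  by apply: (cvgr_lt _ (cg x)); exact: xn.
by apply: filterS => y yn; exists n.
Qed.

Lemma revisits_dense f d (psi : 'I_d -> X -> R) (r : R) (q : nat -> X)
    m (c : 'I_d -> nat) M :
  specification f -> 0 < r ->
  (forall i, nonexpansive (psi i)) -> (forall i x, 0 <= psi i x <= r) ->
  (forall i k j, (k < d.+1)%N ->
    psi i (iter j f (q k)) = r *+ (i == k :> nat)) ->
  (0 < d)%N -> (0 < m)%N -> (forall k, (c k <= m)%N) ->
  dense (revisits f psi r m c M).
Proof.
move=> specf r0 psi_lip psi0r psiq d0 m0 cm O [u Ou] openO.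
have [e e0 uO] : exists2 e : R, 0 < e & ball u e `<=` O.
  by apply/nbhs_ballP; exact: open_nbhs_nbhs.
(* The weights add up to [m * d]: the last orbit gets what the others leave. *)
pose a k := if insub k is Some i then c i else (m * d - \sum_l c l)%N.
have aE : (\sum_(k < d.+1) a k = m * d)%N.
  rewrite big_ord_recr/= {2}/a insubF ?ltnn//.
  rewrite (eq_bigr c) => [|k _]; last by rewrite /a valK.
  rewrite subnKC// mulnC -[X in (_ <= X * _)%N]card_ord -sum_nat_const.
  exact: leq_sum.
have md0 : (0 < m * d)%N by rewrite muln_gt0 m0.
have eta0 : 0 < r / (4 * (m * d)%:R) by rewrite divr_gt0// mulr_gt0// ltr0n.
have A0 : (0 < \sum_(k < d.+1) a k)%N by rewrite aE.
have [x ux [n Mn xn]] :=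
  specification_birkhoff M u specf psi_lip psi0r psiq A0 eta0 e0.
exists x; split; first exact: uO.
exists n => // i; have := xn i; rewrite aE.
rewrite (bigD1 (widen_ord (leqnSn d) i))//= eqxx mulr1n big1 ?addr0.
  by rewrite /a valK [r * (c i)%:R]mulrC.
by move=> k; rewrite -val_eqE/= eq_sym => /negbTE ->; rewrite mulr0.
Qed.

Lemma approximable_near f x (eps delta : R) N : eps < delta ->
  approximable f x eps N -> exists mu : 'I_N -> probability (@borel R X) R,
  exists n0, forall n, (n0 <= n)%N ->
    exists j, (wasserstein1 (empirical f x n) (mu j) < delta%:E)%E.
Proof.
move=> epsdelta [mu muP]; exists mu.
have : (limn_esup (fun n =>
    \big[mine/+oo]_(j < N) wasserstein1 (empirical f x n) (mu j)) < delta%:E)%E.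
  by apply: le_lt_trans muP _; rewrite lte_fin.
move=> /ereal_inf_lt[_ [V [n0 _ n0V] <-]] supV; exists n0 => n n0n.
have /bigmin_ltP[//|[j _ jP]] : (\big[mine/+oo]_(j < N)
    wasserstein1 (empirical f x n) (mu j) < delta%:E)%E.
  apply: le_lt_trans supV; apply: ereal_sup_ubound.
  by exists n => //; exact: n0V.
by exists j.
Qed.

(** Each grid point [c] is approached at a late time, when some measure [mu j]
is within [2 * eps], at most a quarter of the mesh, of the empirical measure.
So the means of the test functions against [mu j] are less than half a mesh
away from [c], and [j] determines [c]. *)
Lemma emergence_ge f x d (psi : 'I_d -> X -> R) (r eps : R) m :
  (forall i, nonexpansive (psi i)) -> (forall i y, 0 <= psi i y <= r) ->
  (0 < d)%N -> (0 < m)%N -> 0 < eps -> 8 * (m * d)%:R * eps <= r ->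
  (forall (c : {ffun 'I_d -> 'I_m}) M,
    revisits f psi r m (fun i => c i) M x) ->
  ((m ^ d)%:R%:E <= emergence f x eps)%E.
Proof.
move=> psi_lip psi0r d0 m0 eps0 epsr xc.
have z0 : 0 < (m * d)%:R :> R by rewrite ltr0n muln_gt0 m0.
rewrite /revisits in xc; set z : R := (m * d)%:R in z0 epsr xc; clearbody z.
have eps2 : eps < 2 * eps by lra.
apply: le_ereal_inf_tmp => _ [N /(approximable_near eps2)[mu [n0 muP]] <-].
rewrite lee_fin ler_nat -[m in X in (X <= _)%N]card_ord.
rewrite -[d in X in (X <= _)%N]card_ord -card_ffun -[X in (_ <= X)%N]card_ord.
(* [J c] is the index of a measure close to the grid point [c]. *)
have /choice[J JP] (c : {ffun 'I_d -> 'I_m}) : exists j, forall i : 'I_d,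
    `|mean (mu j) (psi i) - r * (c i)%:R / z| < r / (2 * z).
  have [n n0n xn] := xc c n0; have [j nj] := muP n n0n.
  exists j => i; have := xn i.
  have := wasserstein1_mean_le (psi_lip i) (psi0r i) nj.
  rewrite mean_empirical//; last by move=> y; case/andP: (psi0r i y).
  rewrite -/(birkhoff f (psi i) n x) => h1 h2.
  have h3 : 2 * eps <= r / (4 * z).
    by rewrite ler_pdivlMr ?mulr_gt0//; lra.
  have h4 : r / (2 * z) = r / (4 * z) + r / (4 * z).
    by field; exact: lt0r_neq0.
  rewrite h4 -(subrKA (birkhoff f (psi i) n x)).
  apply: le_lt_trans (ler_normD _ _) _; rewrite distrC.
  by apply: ler_ltD => //; exact: le_trans h3.
apply: (leq_card J) => c c' cc'; apply/ffunP => i; apply/val_inj/eqP.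
have r0 : 0 < r by apply: lt_le_trans epsr; rewrite !mulr_gt0.
have := JP c i; have := JP c' i; rewrite cc'.
set u := mean _ _ => h1 h2.
have : `|r / z * ((c i)%:R - (c' i)%:R)| < r / z * 1.
  have -> : r / z * ((c i)%:R - (c' i)%:R) =
    (u - r * (c' i)%:R / z) - (u - r * (c i)%:R / z).
    by field; exact: lt0r_neq0.
  apply: le_lt_trans (ler_normB _ _) _.
  have -> : r / z * 1 = r / (2 * z) + r / (2 * z).
    by field; exact: lt0r_neq0.
  exact: ltrD.
rewrite normrM gtr0_norm ?divr_gt0// ltr_pM2l ?divr_gt0// => /ltr_normlP[h3 h4].
have h5 : (c' i)%:R < (c i).+1%:R :> R by rewrite -natr1; lra.
have h6 : (c i)%:R < (c' i).+1%:R :> R by rewrite -natr1; lra.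
by rewrite eqn_leq; move: h5 h6; rewrite !ltr_nat !ltnS => -> ->.
Qed.

(** The witness is the integer part of [eps^(-1/2)], plus one. *)
Lemma grid_size_near0 (d : nat) (r A : R) :
  0 < r -> 2 * A <= d%:R -> (0 < d)%N ->
  \forall eps \near (0 : R)^'+, exists2 m, (0 < m)%N &
    8 * (m * d)%:R * eps <= r /\ A * (- ln eps) <= ln (m ^ d)%:R.
Proof.
move=> r0 Ad d0; have dR : 0 < d%:R :> R by rewrite ltr0n.
pose b := Num.min 1 (r / (16 * d%:R)).
have b0 : 0 < b by rewrite lt_min ltr01/= divr_gt0// mulr_gt0.
near=> eps.
have eps0 : 0 < eps by near: eps; exact: nbhs_right_gt.
have epsb : eps < b ^+ 2 by near: eps; apply: nbhs_right_lt; exact: exprn_gt0.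
pose s := Num.sqrt eps.
have s0 : 0 < s by rewrite sqrtr_gt0.
have sE : eps = s ^+ 2 by rewrite sqr_sqrtr// ltW.
have sb : s < b.
  by rewrite -(ltr_pXn2r (n := 2))// ?nnegrE ?ltW// -sE.
have s1 : s < 1 by apply: lt_le_trans sb _; rewrite ge_min lexx.
have sr : 16 * d%:R * s <= r.
  rewrite mulrC -ler_pdivlMr ?mulr_gt0//; apply: le_trans (ltW sb) _.
  by rewrite ge_min lexx orbT.
pose m := (Num.trunc s^-1).+1.
have ms : s^-1 < m%:R by exact: truncnS_gt.
have sm : m%:R * s <= 2.
  have /andP[mle _] : (Num.trunc s^-1)%:R <= s^-1 < m%:R.
    by apply: truncn_itv; rewrite invr_ge0 ltW.
  have : (Num.trunc s^-1)%:R * s <= 1 by rewrite -ler_pdivlMr// div1r.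
  rewrite /m -natr1; lra.
exists m => //; split.
  apply: le_trans sr.
  have -> : 8 * (m * d)%:R * eps = 8 * d%:R * s * (m%:R * s).
    by rewrite natrM sE; ring.
  have -> : 16 * d%:R * s = 8 * d%:R * s * 2 by ring.
  by rewrite ler_wpM2l// !mulr_ge0// ltW.
have lns : ln eps = 2 * ln s by rewrite sE lnXn// mulr_natl.
have lns0 : ln s < 0 by rewrite ln_lt0// s0.
have lnm : - ln s <= ln m%:R.
  by rewrite -lnV// ler_ln ?posrE ?invr_gt0 ?ltr0n// ltW.
rewrite natrX lnXn ?ltr0n// -[X in _ <= X]mulr_natl lns.
apply: (@le_trans _ _ (d%:R * - ln s)); first by nra.
by rewrite ler_wpM2l// ltW.
Unshelve. all: by end_near. Qed.

End Emergence.

Theorem proposition1p2 (R : realType) (X : pmetricType R) (f : X -> X)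
    (infX : infinite_set [set: X]) (compX : compact [set: X])
    (contf : continuous f) (specf : specification f) :
  exists2 A : set X, residual A &
    forall x : X, A x ->
      (lne (emergence f x eps) / (- ln eps)%:E)%E @[eps --> (0 : R)^'+] --> +oo%E.
Proof.
pose data d := cid (separating_tents d infX specf).
pose r d := projT1 (data d).
pose psi d := projT1 (cid (projT2 (data d))).
have [q psiP] : exists q : nat -> nat -> X, forall d,
  [/\ 0 < r d, forall i, nonexpansive (psi d i),
      forall i x, 0 <= psi d i x <= r d &
      forall i k j, (k < d.+1)%N ->
        psi d i (iter j f (q d k)) = r d *+ (i == k :> nat)].
  exists (fun d => projT1 (cid (projT2 (cid (projT2 (data d)))))) => d.
  exact: projT2 (cid (projT2 (cid (projT2 (data d))))).
(* Grid points are encoded as sequences, whose type does not depend on [d], so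
   that a single countable type indexes all the conditions; entries beyond the
   mesh are capped. *)
pose V (t : nat * nat * seq nat * nat) : set X :=
  let: (d, m, s, M) := t in
  revisits f (psi d.+1) (r d.+1) m.+1 (fun i => minn (nth 0%N s i) m.+1) M.
pose F k := if unpickle k is Some t then V t else setT.
exists (\bigcap_k F k).
  exists (\bigcap_k F k) => //; exists F => // k; rewrite /F.
  case: unpickle => [[[[d m] s] M]|]; last first.
    by split; [exact: openT|move=> O O0 _; rewrite setIT].
  have [r0 psi_lip psi0r psiq] := psiP d.+1; split.
    exact: revisits_open.
  by apply: revisits_dense psiq _ _ _ => // k'; exact: geq_minr.
move=> x xF; apply/cvgeyPge => A.
(* Dimension [d.+1] gives growth of order [eps^(-d.+1 / 2)]. *)
pose d := Num.trunc (2 * A).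
have Ad : 2 * A <= d.+1%:R by apply/ltW/truncnS_gt.
have [r0 psi_lip psi0r psiq] := psiP d.+1.
near=> eps.
have eps0 : 0 < eps by near: eps; exact: nbhs_right_gt.
have eps1 : eps < 1 by near: eps; exact: nbhs_right_lt.
have [m m0 [meps mA]] : exists2 m, (0 < m)%N &
    8 * (m * d.+1)%:R * eps <= r d.+1 /\ A * (- ln eps) <= ln (m ^ d.+1)%:R.
  by near: eps; exact: grid_size_near0.
have lnE : ((ln (m ^ d.+1)%:R)%:E <= lne (emergence f x eps))%E.
  have md0 : 0 < (m ^ d.+1)%:R :> R by rewrite ltr0n expn_gt0 m0.
  have mE : ((m ^ d.+1)%:R%:E <= emergence f x eps)%E.
    apply: emergence_ge meps _ => // c M.
    have := xF (pickle (d, m.-1, [seq val (c i) | i <- enum 'I_d.+1], M)) I.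
    rewrite /F pickleK /V prednK// => -[n Mn xn]; exists n => // i.
    have := xn i; rewrite (nth_map i) ?size_enum_ord// nth_ord_enum.
    rewrite (minn_idPl _); [by []|exact: ltnW (ltn_ord _)].
  rewrite -lne_EFin// lee_lne// in_itv/= leey andbT.
    by rewrite lee_fin ltW.
  by apply: le_trans mE; rewrite lee_fin ltW.
have L0 : 0 < - ln eps by rewrite oppr_gt0 ln_lt0// eps0.
rewrite inver gt_eqF// lee_pdivlMr//.
by apply: le_trans lnE; rewrite -EFinM lee_fin.
Unshelve. all: by end_near. Qed.
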